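(* Let $H$ be the graph on vertex set $\{0,1,2,3\}$ with red edge set $\{\{0,2\},\{0,3\},\{1,3\}\}$ and blue edge set $\{\{0,1\}\}$. Then all of the following hold. (1) $\lambda_H=4/27$. (2) The semi-inducibility problem for $H$ is Erdős–Simonovits $(K_3,(1/3,1/3,1/3))$-stable. (3) The semi-inducibility problem for $H$ is perfectly $K_3$-stable.
   Context: All graphs are finite and simple; the order of a graph is its number of vertices. For a graph $H$ with $\kappa$ vertices whose edges are coloured red or blue and an uncoloured graph $G$ of order $n\ge\kappa$, an embedding of $H$ into $G$ is an injection $V(H)\to V(G)$ that maps red edges of $H$ to edges of $G$ and blue edges of $H$ to non-edges of $G$ (pairs of distinct non-adjacent vertices). $\Lambda_H(G)$ is the number of embeddings, $\lambda_H(G):=\Lambda_H(G)/\big(n(n-1)\cdots(n-\kappa+1)\big)$, $\lambda_H(n)$ is the maximum of $\lambda_H(G)$ over all graphs $G$ of order $n$, and $\lambda_H:=\lim_{n\to\infty}\lambda_H(n)$ (the limit exists). For a graph $B$ on $\{0,\dots,m-1\}$ and pairwise disjoint finite sets $V_0,\dots,V_{m-1}$ (some possibly empty), the blowup $B(V_0,\dots,V_{m-1})$ is the graph on $\bigcup_i V_i$ in which $x\in V_i$ and $y\in V_j$ are adjacent if and only if $\{i,j\}\in E(B)$ (so each $V_i$ is independent). The edit distance $\delta_{\mathrm{edit}}(G,G')$ between two graphs of the same order is the minimum of $|f(E(G))\bigtriangleup E(G')|$ over all bijections $f:V(G)\to V(G')$. Let $\mathbf x=(x_0,\dots,x_{m-1})$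 be a vector of non-negative reals summing to $1$. The semi-inducibility problem for $H$ is Erdős–Simonovits $(B,\mathbf x)$-stable if for every $\varepsilon>0$ there are $\delta>0$ and $n_0$ such that every graph $G$ of order $n\ge n_0$ with $\lambda_H(G)\ge\lambda_H-\delta$ admits a partition $V(G)=V_0\cup\dots\cup V_{m-1}$ with $\big||V_i|-x_in\big|<\varepsilon n$ for all $i$ and $|E(G)\bigtriangleup E(B(V_0,\dots,V_{m-1}))|\le\varepsilon\binom n2$. The semi-inducibility problem for $H$ is perfectly $B$-stable if there is $C>0$ such that for every graph $G$ of order $n\ge C$ there is a blowup $G'$ of $B$ of order $n$ with $\delta_{\mathrm{edit}}(G,G')\le C\,(\lambda_H(n)-\lambda_H(G))\,n^2$. (Here $C\ge\kappa$ may be assumed.) *)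

(* Defs.v *)
From HB Require Import structures.
From mathcomp Require Import all_boot all_order all_algebra.
From mathcomp Require Import all_classical all_reals all_analysis.

Set Implicit Arguments.
Unset Strict Implicit.
Unset Printing Implicit Defensive.

Import Order.TTheory GRing.Theory Num.Theory.
Import numFieldNormedType.Exports.

Local Open Scope ring_scope.

Record sgraph (T : finType) := SGraph {
  edges :> {set {set T}};
  edgesP : [forall e in edges, #|e| == 2%N] }.

HB.instance Definition _ (T : finType) := [isSub for @edges T].
HB.instance Definition _ (T : finType) := [Finite of sgraph T by <:].

Definition adj (T : finType) (G : sgraph T) : rel T :=
  fun x y => [set x; y] \in edges G.

Lemma edges2P (T : finType) (P : pred {set T}) :
  [forall e in [set e : {set T} | (#|e| == 2%N) && P e], #|e| == 2%N].
Proof. by apply/'forall_implyP => e; rewrite inE => /andP[]. Qed.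

Definition complete (T : finType) : sgraph T :=
  SGraph (edges2P (fun _ : {set T} => true)).

(* Only used with r symmetric. *)
Definition sgraph_of_rel (T : finType) (r : rel T) : sgraph T :=
  SGraph (edges2P
    (fun e : {set T} => [exists x, exists y, (e == [set x; y]) && r x y])).

Definition symdiff (T : finType) (A B : {set T}) : {set T} :=
  (A :\: B) :|: (B :\: A).

(* Parts may be empty, unlike the blocks of finset's partition. *)
Definition is_parts (T : finType) (m : nat) (V : 'I_m -> {set T}) : Prop :=
  \bigcup_(i < m) V i = [set: T] /\
  forall i j : 'I_m, i != j -> [disjoint V i & V j].

Definition blowup (T : finType) (m : nat) (B : sgraph 'I_m)
    (V : 'I_m -> {set T}) : sgraph T :=
  sgraph_of_rel (fun x y : T =>
    [exists i, exists j, [&& x \in V i, y \in V j & adj B i j]]).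

Definition is_blowup (T : finType) (m : nat) (B : sgraph 'I_m)
    (G : sgraph T) : Prop :=
  exists2 V : 'I_m -> {set T}, is_parts V & G = blowup B V.

(* The default value #|E(G)| + #|E(G')| of the iterated minimum bounds every
   term from above, so for #|T| = #|T'| it does not affect the result. *)
Definition edit_distance (T T' : finType) (G : sgraph T) (G' : sgraph T')
    : nat :=
  \big[minn/(#|edges G| + #|edges G'|)%N]_(f : {ffun T -> T'} |
      injectiveb f && [forall y, y \in codom f])
    #|symdiff [set f @: e | e : {set T} in edges G] (edges G')|.

Record cgraph (W : finType) := CGraph {
  red : sgraph W;
  blue : sgraph W;
  red_blueP : [disjoint edges red & edges blue] }.

Definition is_embedding (W T : finType) (H : cgraph W) (G : sgraph T)
    (f : {ffun W -> T}) : bool :=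
  [&& injectiveb f,
      [forall e in edges (red H), f @: e \in edges G] &
      [forall e in edges (blue H), f @: e \notin edges G]].

Definition num_embeddings (W T : finType) (H : cgraph W) (G : sgraph T)
    : nat := #|[set f : {ffun W -> T} | is_embedding H G f]|.

(* Meaningful for #|W| <= #|T|; otherwise the value is 0 / 0 = 0. *)
Definition density (R : realType) (W T : finType) (H : cgraph W)
    (G : sgraph T) : R :=
  (num_embeddings H G)%:R / (#|T| ^_ #|W|)%:R.

Definition max_density (R : realType) (W : finType) (H : cgraph W)
    (n : nat) : R :=
  \big[Num.max/0]_(G : sgraph 'I_n) density R H G.

Definition semi_inducibility (R : realType) (W : finType) (H : cgraph W) : R :=
  limn (max_density R H).

(* x is meant to be a probability vector. *)
Definition ES_stable (R : realType) (W : finType) (H : cgraph W) (m : nat)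
    (B : sgraph 'I_m) (x : 'I_m -> R) : Prop :=
  forall eps : R, 0 < eps ->
  exists2 delta : R, 0 < delta &
  exists n0 : nat, forall (T : finType) (G : sgraph T),
    (n0 <= #|T|)%N ->
    semi_inducibility R H - delta <= density R H G ->
    exists V : 'I_m -> {set T},
      [/\ is_parts V,
          forall i : 'I_m, `| #|V i|%:R - x i * #|T|%:R | < eps * #|T|%:R &
          #|symdiff (edges G) (edges (blowup B V))|%:R
            <= eps * 'C(#|T|, 2)%:R].

(* The bound #|W| <= C ensures that only orders for which the densities are
   meaningful are involved; it loses nothing, as C may always be enlarged. *)
Definition perfectly_stable (R : realType) (W : finType) (H : cgraph W)
    (m : nat) (B : sgraph 'I_m) : Prop :=
  exists C : R, [/\ 0 < C, #|W|%:R <= C &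
    forall (T : finType) (G : sgraph T), C <= #|T|%:R ->
    exists (T' : finType) (G' : sgraph T'),
      [/\ #|T'| = #|T|, is_blowup B G' &
          (edit_distance G G')%:R
            <= C * (max_density R H #|T| - density R H G) * #|T|%:R ^+ 2]].

Local Notation v k := (@Ordinal 4 k isT).

Lemma H4_redP : [forall e in
  [set [set v 0; v 2]; [set v 0; v 3]; [set v 1; v 3]], #|e| == 2%N].
Proof.
by apply/'forall_implyP => e; rewrite !inE => /orP[/orP[]|] /eqP->; rewrite cards2.
Qed.

Lemma H4_blueP : [forall e in [set [set v 0; v 1]], #|e| == 2%N].
Proof. by apply/'forall_implyP => e; rewrite !inE => /eqP->; rewrite cards2. Qed.

Lemma H4_red_blueP :
  [disjoint edges (SGraph H4_redP) & edges (SGraph H4_blueP)].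
Proof.
rewrite disjoint_sym disjoints1 /= !inE !negb_or -andbA.
by apply/and3P; split; apply/eqP => /setP E;
  [have := E (v 1) | have := E (v 1) | have := E (v 0)]; rewrite !inE.
Qed.

Definition H4 : cgraph 'I_4 := CGraph H4_red_blueP.

(* Main.v *)
(** Let [d] be the degree and [t] the number of cocherries (an edge [u w] and a
    vertex adjacent to neither end) at [u]. Counting embeddings by the image [u]
    of the vertex 0 gives
      [Lambda = \sum_u (d - 1) ((n - 1 - d) d - t)],
    which is largest when all degrees are about [2 n / 3] and there is no
    cocherry, i.e. for the balanced complete tripartite graph. For a graph
    losing [L] from the upper bound, almost all degrees are close to [2 n / 3]
    and there are [O(L / n)] cocherries, so averaging finds a triangle with
    typical degrees on which few cocherries lie. Colouring the vertices by their
    adjacencies to this triangle is a partition with [O(L / n^2)] wrongly placed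
    pairs; a wrong pair outside the common neighbourhood of the triangle forms a
    cocherry with one of its vertices, and that common neighbourhood is small.
    Finally, a graph at bounded distance from an almost balanced complete
    tripartite graph loses order [n^2] per wrong pair, since each of these
    pairs creates about [n / 3] cocherries. *)
Require Import Defs.
From mathcomp Require Import all_boot all_order all_algebra.
From mathcomp Require Import all_classical all_reals all_analysis.
From mathcomp Require Import ring lra zify.
Import Order.TTheory GRing.Theory Num.Theory.
Import numFieldNormedType.Exports.
Set Implicit Arguments.
Unset Strict Implicit.
Unset Printing Implicit Defensive.
Local Open Scope ring_scope.

(** * Cocherries and the counting functions *)

Definition nadj (T : finType) (a : rel T) : rel T :=
  fun u v => (u != v) && ~~ a u v.

(** Three vertices inducing exactly one edge, i.e. the complement of a cherry. The graphs without
    cocherries are the complete multipartite ones. *)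
Definition cocherry (T : finType) (a : rel T) (x y z : T) : bool :=
  [|| [&& a x y, nadj a x z & nadj a y z],
      [&& nadj a x y, a x z & nadj a y z] |
      [&& nadj a x y, nadj a x z & a y z]].

Section Counting.
Variables (R : realFieldType) (T : finType) (a : rel T).

Definition deg (u : T) : R := \sum_v (a u v)%:R.

(* Cocherries whose edge contains [u], the other vertex [v] being isolated. *)
Definition cot (u : T) : R :=
  \sum_v \sum_w [&& nadj a u v, a u w & nadj a v w]%:R.

(** The embedding count of [H4]: [u], [v], [w], [z] are the images of 0, 1, 3, 2. The remaining
    inequalities follow from the adjacencies once [a] is symmetric and irreflexive. *)
Definition Lam : R :=
  \sum_u \sum_v \sum_w \sum_z
    [&& nadj a u v, a u w, a v w, a u z & z != w]%:R.

(** The pairs are ordered, so each cocherry through [x] counts twice. *)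
Definition ccdeg (x : T) : R := \sum_y \sum_z (cocherry a x y z)%:R.
Definition cccodeg (x y : T) : R := \sum_z (cocherry a x y z)%:R.

Hypotheses (a_sym : symmetric a) (a_irr : irreflexive a).

Lemma sum_nat1 : \sum_(u : T) 1 = #|T|%:R :> R.
Proof. by rewrite sumr_const. Qed.

Lemma sum_eq1 (w : T) : \sum_z (z == w)%:R = 1 :> R.
Proof.
by rewrite (bigD1 w) //= eqxx big1 ?addr0 // => z /negPf ->.
Qed.

Lemma nadj_sym : symmetric (nadj a).
Proof. by move=> u v; rewrite /nadj eq_sym a_sym. Qed.

Lemma nadjE u v : (nadj a u v)%:R = 1 - (v == u)%:R - (a u v)%:R :> R.
Proof.
rewrite /nadj (eq_sym v); case: eqVneq => [->|_];
  rewrite ?a_irr /= ?subr0 ?subrr //.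
by case: (a u v); rewrite /= ?subrr ?subr0.
Qed.

Lemma sum_nadj u : \sum_v (nadj a u v)%:R = #|T|%:R - 1 - deg u.
Proof.
rewrite (eq_bigr _ (fun v _ => nadjE u v)) !big_split /= sum_nat1.
by rewrite !sumrN sum_eq1.
Qed.

Lemma deg_ge0 u : 0 <= deg u.
Proof. by apply: sumr_ge0. Qed.

Lemma deg_le u : deg u <= #|T|%:R - 1.
Proof. by rewrite -subr_ge0 -sum_nadj; apply: sumr_ge0. Qed.

Lemma cot_ge0 u : 0 <= cot u.
Proof. by apply: sumr_ge0 => v _; apply: sumr_ge0. Qed.

Lemma cot_compl u :
  \sum_v \sum_w [&& nadj a u v, a u w & a v w]%:R
  = (#|T|%:R - 1 - deg u) * deg u - cot u.
Proof.
apply/eqP; rewrite eq_sym subr_eq; apply/eqP.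
rewrite /cot -big_split /= -sum_nadj /deg mulr_suml.
apply: eq_bigr => v _; rewrite -big_split /= mulr_sumr.
apply: eq_bigr => w _; rewrite /nadj.
case: (eqVneq v w) => [<-|vw]; rewrite ?a_irr /=;
  case: (a u v); case: (u == v); case: (a u w);
  rewrite ?andbF ?mulr0 ?mul0r ?mulr1 ?addr0 ?add0r //=.
by case: (a v w); rewrite ?addr0 ?add0r.
Qed.

Lemma cot_le u : cot u <= (#|T|%:R - 1 - deg u) * deg u.
Proof.
by rewrite -subr_ge0 -cot_compl; apply: sumr_ge0 => v _; apply: sumr_ge0.
Qed.

(** With [u], [v], [w] fixed, [z] is any neighbour of [u] other than [w], whence the factor
    [deg u - 1]. The pairs [v], [w] are those of [cot_compl]. *)
Lemma LamE :
  Lam = \sum_u (deg u - 1) * ((#|T|%:R - 1 - deg u) * deg u - cot u).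
Proof.
apply: eq_bigr => u _; rewrite -cot_compl mulr_sumr.
apply: eq_bigr => v _; rewrite mulr_sumr; apply: eq_bigr => w _.
case uv: (nadj a u v); last by rewrite /= mulr0 big1.
case uw: (a u w); last by rewrite /= mulr0 big1.
case vw: (a v w); last by rewrite /= mulr0 big1.
rewrite /= mulr1 /deg (bigD1 w) //= uw eqxx add0r.
rewrite [in RHS](bigD1 w) //= uw addrAC subrr add0r.
by apply: eq_bigr => z ->; rewrite andbT.
Qed.

(** Settles the one case in which the coefficient [deg u - 1] of [cot u] in the loss is negative:
    then [u] has no neighbour. *)
Lemma cot_deg_lt1 u : deg u < 1 -> cot u = 0.
Proof.
move=> d1; rewrite /cot big1 // => v _; rewrite big1 // => w _.
case uw: (a u w); last by rewrite andbF.
have : 1 <= deg u; last by lra.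
rewrite /deg (bigD1 w) //= uw -[X in X <= _]addr0 lerD2l.
by apply: sumr_ge0.
Qed.

(** A cocherry gives 6 ordered triples on the left, but only 2 on the right, one for each end of its
    edge. *)
Lemma ccdegE : \sum_x ccdeg x = 3 * \sum_x cot x.
Proof.
have E x y z : (cocherry a x y z)%:R =
  [&& nadj a x y, a x z & nadj a y z]%:R
  + [&& nadj a x z, a x y & nadj a z y]%:R
  + [&& nadj a y x, a y z & nadj a x z]%:R :> R.
  rewrite /cocherry (nadj_sym z y) (nadj_sym y x) /nadj.
  by case: (a x y); case: (a x z); case: (a y z);
    case: (x == y); case: (x == z); case: (y == z); rewrite /= ?addr0 ?add0r.
have -> : \sum_x ccdeg x = \sum_x cot x + \sum_x cot x + \sum_x cot x.
  transitivity (\sum_x (\sum_y \sum_z [&& nadj a x y, a x z & nadj a y z]%:R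
    + \sum_y \sum_z [&& nadj a x z, a x y & nadj a z y]%:R
    + \sum_y \sum_z [&& nadj a y x, a y z & nadj a x z]%:R) : R).
    apply: eq_bigr => x _; rewrite -!big_split /=; apply: eq_bigr => y _.
    by rewrite -!big_split /=; apply: eq_bigr => z _; rewrite E.
  rewrite !big_split /=; congr (_ + _ + _).
    by apply: eq_bigr => x _; rewrite exchange_big.
  by rewrite exchange_big.
by ring.
Qed.

Lemma ccdeg_ge0 x : 0 <= ccdeg x.
Proof. by apply: sumr_ge0 => v _; apply: sumr_ge0. Qed.

Lemma cccodeg_ge0 x y : 0 <= cccodeg x y.
Proof. by apply: sumr_ge0. Qed.

End Counting.

(** * The cubic bound on the contribution of one vertex *)

(* A vertex of degree [d] lying on no cocherry contributes
   [(n - 1 - d) d (d - 1)] to [Lam]; [cap n] is an upper bound for it which is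
   almost attained at [d = 2 n / 3]. *)
Definition cap (R : realFieldType) (n : R) : R :=
  4 / 27 * n ^+ 3 - 2 / 3 * n ^+ 2 + 5 / 3 * n.

Section Cap.
Variable R : realFieldType.
Implicit Types n e d t eta : R.

(** Here [e] is the deviation of the degree from [2 n / 3]; a nonnegative degree means
    [e >= - 2 n / 3], the standing assumption below. *)
Lemma cap_sub n e :
  cap n - (n - 1 - (2 / 3 * n + e)) * (2 / 3 * n + e) * (2 / 3 * n + e - 1)
  = n + (n - 1) * e + e ^+ 2 * (n + e).
Proof. by rewrite /cap; field. Qed.

Lemma capsub_quad n e : - (2 / 3 * n) <= e ->
  n * (1 + e + e ^+ 2 / 3) - e <= n + (n - 1) * e + e ^+ 2 * (n + e).
Proof.
move=> He; have := mulr_ge0 (sqr_ge0 e) (_ : 0 <= 2 / 3 * n + e).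
have -> : 0 <= 2 / 3 * n + e by lra.
by move=> /(_ isT); nra.
Qed.

Lemma capsub_ge n e : 2 <= n -> - (2 / 3 * n) <= e ->
  n / 5 <= n + (n - 1) * e + e ^+ 2 * (n + e).
Proof.
move=> Hn He; apply: le_trans (capsub_quad He).
(* Completing the square, [1 + e + e^2 / 3 = (e + 3/2)^2 / 3 + 1/4]; two of the [n] squares are
   spent on the term [- e]. *)
have -> : n * (1 + e + e ^+ 2 / 3) - e =
  n / 4 + (n - 2) / 3 * (e + 3 / 2) ^+ 2
  + 2 / 3 * (e + 3 / 4) ^+ 2 + 9 / 8 by field.
have := mulr_ge0 (_ : 0 <= (n - 2) / 3) (sqr_ge0 (e + 3 / 2)).
have -> : 0 <= (n - 2) / 3 by lra.
move=> /(_ isT); have := sqr_ge0 (e + 3 / 4); lra.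
Qed.

Lemma capsub_far n e eta : 0 < eta -> 6 <= eta * n -> 1 <= n ->
  - (2 / 3 * n) <= e -> eta * n <= `|e| ->
  eta ^+ 2 * n ^+ 3 / 6 <= n + (n - 1) * e + e ^+ 2 * (n + e).
Proof.
move=> eta0 H6 n1 He Habs; have n0 : 0 <= n by lra.
 apply: le_trans (capsub_quad He).
have Hsq : (eta * n) ^+ 2 <= e ^+ 2.
  by rewrite -(real_normK (num_real e)) lerXn2r ?nnegrE //; lra.
have -> : eta ^+ 2 * n ^+ 3 / 6 = n * ((eta * n) ^+ 2) / 6 by field.
apply: (@le_trans _ _ (n * e ^+ 2 / 6)).
  by have := ler_wpM2l n0 Hsq; lra.
(* One half of [e^2 / 3] is kept for the bound; for negative [e] the other half absorbs the linear
   term because [e <= -6]. *)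
case: (ler0P e) => e0.
  have H1 : 6 <= - e by move: Habs; rewrite ler0_norm //; lra.
  have H2 : 0 <= e ^+ 2 / 6 + e by nra.
  by have := mulr_ge0 n0 H2; nra.
have H2 : 0 <= n * (e ^+ 2 / 6) by rewrite mulr_ge0 //; have := sqr_ge0 e; lra.
by have := mulr_ge0 (_ : 0 <= n - 1) (ltW e0); rewrite subr_ge0 => /(_ n1); lra.
Qed.

Lemma capsub_le n e : 1 <= n -> `|e| <= 1 ->
  n + (n - 1) * e + e ^+ 2 * (n + e) <= 3 * n.
Proof.
move=> n1; rewrite ler_norml => /andP[l u].
have H : e ^+ 2 <= 1 by nra.
have := mulr_ge0 (_ : 0 <= 1 - e ^+ 2) (_ : 0 <= n + e).
have -> : 0 <= 1 - e ^+ 2 by lra.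
have -> : 0 <= n + e by lra.
by move=> /(_ isT isT); nra.
Qed.

(* In terms of [t] the bound is affine, so it suffices to check it at the two
   extreme values of [t] when [d] is small. *)
Lemma loss_cot n d t : 20 <= n -> 0 <= d -> 0 <= t -> (d < 1 -> t = 0) ->
  t <= (n - 1 - d) * d ->
  n / 5 * t <= cap n - (d - 1) * ((n - 1 - d) * d - t).
Proof.
move=> Hn d0 t0 t1 tle.
have cs : 0 <= cap n - (n - 1 - d) * d * (d - 1).
  have -> : d = 2 / 3 * n + (d - 2 / 3 * n) by ring.
  rewrite cap_sub; apply: le_trans (capsub_ge _ _); lra.
have [dbig|dsmall] := lerP (n / 5) (d - 1).
  have := mulr_ge0 (_ : 0 <= d - 1 - n / 5) t0.
  by rewrite subr_ge0 => /(_ dbig); nra.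
have [d1|d1] := ltrP d 1; first by rewrite t1 // mulr0 subr0; nra.
have H1 := mulr_ge0 (_ : 0 <= n / 5 - (d - 1)) (_ : 0 <= (n - 1 - d) * d - t).
have {}H1 : 0 <= (n / 5 - (d - 1)) * ((n - 1 - d) * d - t) by apply: H1; lra.
(* At the extreme [t = (n - 1 - d) * d] no embedding is left. As [d < n / 5 + 1], the left side is
   at most about [n^3 / 25], well below [4 n^3 / 27]. *)
suff : n / 5 * ((n - 1 - d) * d) <= cap n by nra.
apply: (@le_trans _ _ (n / 5 * (n * (n / 5 + 1)))).
  apply: ler_wpM2l; first lra.
  by nra.
rewrite /cap; have n0 : 0 <= n by lra.
have -> : n / 5 * (n * (n / 5 + 1)) = n * (n ^+ 2 / 25 + n / 5) by field.
have -> : 4 / 27 * n ^+ 3 - 2 / 3 * n ^+ 2 + 5 / 3 * n =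
  n * (4 / 27 * n ^+ 2 - 2 / 3 * n + 5 / 3) by ring.
apply: ler_wpM2l => //; nra.
Qed.
End Cap.

(** * Lower bounds on the loss *)

Section Loss.
Variables (R : realFieldType) (T : finType) (a : rel T).
Hypotheses (a_sym : symmetric a) (a_irr : irreflexive a).
Local Notation n := (#|T|%:R : R).
Local Notation deg := (@deg R T a).
Local Notation cot := (@cot R T a).
Local Notation ccdeg := (@ccdeg R T a).
Local Notation cccodeg := (@cccodeg R T a).

Definition loss (u : T) : R :=
  cap n - (deg u - 1) * ((n - 1 - deg u) * deg u - cot u).

Definition Loss : R := n * cap n - Lam R a.

Lemma LossE : Loss = \sum_u loss u.
Proof. by rewrite /Loss LamE // /loss sumrB sumr_const mulr_natl. Qed.

Lemma loss_split u : loss u =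
  cap n - (n - 1 - deg u) * deg u * (deg u - 1) + (deg u - 1) * cot u.
Proof. by rewrite /loss; ring. Qed.

Lemma capsub_loss u (e := deg u - 2 / 3 * n) :
  n + (n - 1) * e + e ^+ 2 * (n + e) <= loss u.
Proof.
rewrite loss_split.
have dE : deg u = 2 / 3 * n + e by rewrite /e; ring.
rewrite -cap_sub -dE lerDl.
have [d1|d1] := ltrP (deg u) 1; first by rewrite cot_deg_lt1 // mulr0.
by rewrite mulr_ge0 ?cot_ge0 // subr_ge0.
Qed.

Lemma dev_ge u : - (2 / 3 * n) <= deg u - 2 / 3 * n.
Proof. by have := deg_ge0 R a u; lra. Qed.

Lemma loss_ge u : 2 <= n -> n / 5 <= loss u.
Proof.
by move=> n2; apply: le_trans (capsub_loss u); apply: capsub_ge (dev_ge u).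
Qed.

Lemma loss_ge_cot u : 20 <= n -> n / 5 * cot u <= loss u.
Proof.
move=> n20; apply: loss_cot => //; first exact: deg_ge0.
- exact: cot_ge0.
- exact: cot_deg_lt1.
- exact: cot_le.
Qed.

Lemma Loss_ge : 2 <= n -> n ^+ 2 / 5 <= Loss.
Proof.
move=> n2; rewrite LossE.
have -> : n ^+ 2 / 5 = \sum_(u : T) n / 5.
  by rewrite sumr_const -[RHS]mulr_natl -/n; ring.
by apply: ler_sum => u _; apply: loss_ge.
Qed.

Lemma Loss_ge_cc : 20 <= n -> n * \sum_x ccdeg x <= 15 * Loss.
Proof.
move=> n20; rewrite ccdegE //.
have : n / 5 * \sum_u cot u <= Loss.
  by rewrite LossE mulr_sumr; apply: ler_sum => u _; apply: loss_ge_cot.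
lra.
Qed.

(** A vertex whose degree is off by [eta n] loses order [eta^2 n^3] by [capsub_far], and every other
    vertex has a nonnegative loss. *)
Lemma Loss_far (eta : R) (P : pred T) : 0 < eta -> 6 <= eta * n -> 2 <= n ->
  (forall u, P u -> eta * n <= `|deg u - 2 / 3 * n|) ->
  eta ^+ 2 * n ^+ 3 * \sum_u (P u)%:R <= 6 * Loss.
Proof.
move=> eta0 H6 n2 HP; rewrite LossE mulr_sumr mulr_sumr.
apply: ler_sum => u _; case Pu: (P u).
  have := @capsub_far R n _ eta eta0 H6 _ (dev_ge u) (HP u Pu).
  have -> : 1 <= n by lra.
  by move=> /(_ isT) H; have := le_trans H (capsub_loss u); rewrite mulr1; lra.
by rewrite mulr0; have := loss_ge u n2; lra.
Qed.

Lemma sum_const_r (c : R) : \sum_(u : T) c = n * c.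
Proof. by rewrite sumr_const mulr_natl. Qed.

(** * A typical triangle lying on few cocherries *)

Variable eta : R.
Hypotheses (eta0 : 0 < eta) (eta1 : eta <= 1 / 100) (eta6 : 72 <= eta * n).
Hypothesis Loss_small : Loss <= eta ^+ 3 / 6 * n ^+ 4.

Let etan_le : eta * n <= n / 100.
Proof.
by rewrite [leRHS]mulrC ler_wpM2r ?ler0n //; move: eta1; rewrite div1r.
Qed.

Let n_big : 720 <= n.
Proof.
by move: eta6 etan_le; lra.
Qed.

Definition typical u := `|deg u - 2 / 3 * n| <= eta * n.

(** The factor [eta^3 / 6] in [Loss_small] is what [Loss_far] turns into [eta n] exceptional
    vertices. *)
Lemma sum_atypical : \sum_u (~~ typical u)%:R <= eta * n :> R.
Proof.
have H : eta ^+ 2 * n ^+ 3 * \sum_u (~~ typical u)%:R <= 6 * Loss.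
  apply: Loss_far => //; [by move: eta6; lra|by have := n_big; lra|].
  by move=> u; rewrite /typical -ltNge => /ltW.
have P : 0 < eta ^+ 2 * n ^+ 3.
  by rewrite mulr_gt0 ?exprn_gt0 //; have := n_big; lra.
rewrite -(ler_pM2l P); apply: le_trans H _.
by by move: Loss_small; lra.
Qed.

Let tt x : R := (typical x)%:R.
(** Two neighbourhoods of size about [2 n / 3] meet in about [n / 3] vertices, of which at most
    [eta n] are atypical. *)
Lemma tri_inner x y : typical x -> typical y ->
  3 / 10 * n <= \sum_z tt z * (a x z)%:R * (a y z)%:R.
Proof.
move=> tx ty.
apply: (@le_trans _ _ 
  (\sum_z ((a x z)%:R + (a y z)%:R - 1 - (~~ typical z)%:R))).
  rewrite !big_split /= !sumrN sum_nat1 -/(deg x) -/(deg y).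
  have := sum_atypical; move: tx ty; rewrite /typical !ler_norml.
  have := n_big; have := etan_le; lra.
apply: ler_sum => z _; rewrite /tt.
by case: (a x z); case: (a y z); case: (typical z); rewrite /=; lra.
Qed.

Lemma tri_middle x : typical x ->
  3 / 5 * n <= \sum_y tt y * (a x y)%:R.
Proof.
move=> tx.
apply: (@le_trans _ _ (\sum_z ((a x z)%:R - (~~ typical z)%:R))).
  rewrite big_split /= sumrN -/(deg x).
  have := sum_atypical; move: tx; rewrite /typical !ler_norml.
  have := n_big; have := etan_le; lra.
apply: ler_sum => z _; rewrite /tt.
by case: (a x z); case: (typical z); rewrite /=; lra.
Qed.

Lemma tri_outer : 99 / 100 * n <= \sum_x tt x.
Proof.
apply: (@le_trans _ _ (\sum_z (1 - (~~ typical z)%:R))).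
  rewrite big_split /= sumrN sum_nat1.
  have := sum_atypical.
  have := n_big; have := etan_le; lra.
apply: ler_sum => z _; rewrite /tt.
by case: (typical z); rewrite /=; lra.
Qed.

Definition good_triple x y z :=
  [&& typical x, typical y, typical z, a x y, a x z & a y z].

(** Choosing [x], then [y], then [z] leaves at least [99/100 n], [3/5 n] and [3/10 n] candidates. *)
Lemma sum_good_triple :
  n ^+ 3 / 10 <= \sum_x \sum_y \sum_z (good_triple x y z)%:R.
Proof.
have n0 : 0 <= n by exact: ler0n.
apply: (@le_trans _ _ (\sum_x tt x * (3 / 5 * n * (3 / 10 * n)))).
  rewrite -mulr_suml.
  have H : 0 <= 3 / 5 * n * (3 / 10 * n) by rewrite !mulr_ge0 //; lra.
  apply: le_trans (ler_wpM2r H tri_outer).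
  have := exprn_ge0 3 n0; lra.
apply: ler_sum => x _; rewrite /tt; case tx: (typical x); last first.
  by rewrite mul0r; apply: sumr_ge0 => y _; apply: sumr_ge0.
rewrite mul1r; apply: (@le_trans _ _ (\sum_y tt y * (a x y)%:R * (3 / 10 * n))).
  by rewrite -mulr_suml ler_wpM2r ?tri_middle //; lra.
apply: ler_sum => y _; rewrite /tt.
case ty: (typical y); last by rewrite !mul0r; apply: sumr_ge0.
case xy: (a x y); last by rewrite mulr0 mul0r; apply: sumr_ge0.
rewrite !mul1r; apply: le_trans (tri_inner tx ty) _.
apply: ler_sum => z _; rewrite /tt /good_triple tx ty xy.
by case: (typical z); case: (a x z); case: (a y z);
  rewrite /= ?mulr0 ?mul0r ?mulr1.
Qed.

(** The weight [n] on the codegrees gives all six terms the same sum over all triples, namely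
    [n^2 * \sum_x ccdeg x]. *)
Definition tri_cost x y z : R :=
  ccdeg x + ccdeg y + ccdeg z
  + n * (cccodeg x y + cccodeg y z + cccodeg x z).

Lemma tri_cost_ge0 x y z : 0 <= tri_cost x y z.
Proof.
rewrite /tri_cost !addr_ge0 ?ccdeg_ge0 // mulr_ge0 ?ler0n //.
by rewrite !addr_ge0 ?cccodeg_ge0.
Qed.

Lemma sum_tri_cost :
  \sum_x \sum_y \sum_z tri_cost x y z = 6 * n ^+ 2 * \sum_x ccdeg x.
Proof.
have A : \sum_x \sum_y cccodeg x y = \sum_x ccdeg x by [].
transitivity (\sum_x \sum_y (n * ccdeg x + n * ccdeg y + \sum_z ccdeg z
   + n * (n * cccodeg x y + ccdeg y + ccdeg x))).
  apply: eq_bigr => x _; apply: eq_bigr => y _.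
  by rewrite /tri_cost !big_split /= -!mulr_sumr !big_split /= !sum_const_r.
transitivity (\sum_x (n * (n * ccdeg x) + n * (\sum_y ccdeg y)
   + n * (\sum_y ccdeg y)
   + n * (n * ccdeg x + (\sum_y ccdeg y) + n * ccdeg x))).
  apply: eq_bigr => x _.
  by rewrite !big_split /= -!mulr_sumr !big_split /= !sum_const_r -!mulr_sumr.
rewrite !big_split /= -!mulr_sumr !big_split /= !sum_const_r -!mulr_sumr.
by ring.
Qed.

Lemma good_triple_exists : exists x y z,
  good_triple x y z /\ n ^+ 2 * tri_cost x y z <= 1445 * Loss.
Proof.
have nb := n_big; have n20 : 20 <= n by lra.
have n2 : 2 <= n by lra.
have n0 : 0 < n by lra.
(* If every good triple cost at least [c], the total [6 n^2 Q] would be at least [c n^3 / 10]. The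
   summand 1 in [c] makes the contradiction strict even for [Q = 0]. *)
set Q := \sum_x ccdeg x; set c := 96 * Q / n + 1.
have Q0 : 0 <= Q by apply: sumr_ge0 => x _; apply: ccdeg_ge0.
have [/existsP[x /existsP[y /existsP[z /andP[gt cost]]]]|] :=
  boolP [exists x, exists y, exists z,
           good_triple x y z && (tri_cost x y z < c)].
  exists x, y, z; split=> //.
  (* These bound [96 n Q] by [96 * 15] losses and [n^2] by 5 losses, hence [1445]. *)
  have HQ := Loss_ge_cc n20; have HL := Loss_ge n2.
  apply: (@le_trans _ _ (n ^+ 2 * c)).
    by rewrite ler_wpM2l ?exprn_ge0 ?ltW.
  have -> : n ^+ 2 * c = 96 * (n * Q) + n ^+ 2.
    by rewrite /c; field; rewrite gt_eqF.
  by rewrite -/Q in HQ; lra.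
rewrite negb_exists => /forallP H; exfalso.
have : c * (n ^+ 3 / 10) <= 6 * n ^+ 2 * Q.
  rewrite -sum_tri_cost; apply: (@le_trans _ _
    (c * \sum_x \sum_y \sum_z (good_triple x y z)%:R)).
    rewrite ler_wpM2l ?sum_good_triple //.
    by apply: addr_ge0 => //; apply: divr_ge0; [apply: mulr_ge0|apply: ltW].
  rewrite mulr_sumr; apply: ler_sum => x _.
  rewrite mulr_sumr; apply: ler_sum => y _.
  rewrite mulr_sumr; apply: ler_sum => z _.
  have := H x; rewrite negb_exists => /forallP/(_ y).
  rewrite negb_exists => /forallP/(_ z).
  case: good_triple; rewrite /= ?mulr0 ?mulr1 ?tri_cost_ge0 // -leNgt //.
have -> : c * (n ^+ 3 / 10) = 48 / 5 * (n ^+ 2 * Q) + n ^+ 3 / 10.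
  by rewrite /c; field; rewrite gt_eqF.
have := exprn_gt0 3 n0; have := mulr_ge0 (exprn_ge0 2 (ltW n0)) Q0.
by lra.
Qed.

End Loss.

(** * Colouring by a triangle and counting wrong pairs *)

Section Edits.
Variables (T : finType) (a : rel T).

Definition edited (c : T -> 'I_3) : rel T :=
  fun u v => a u v != (c u != c v).

Variable R : realFieldType.

Definition edits (c : T -> 'I_3) : R := \sum_u \sum_v (edited c u v)%:R.

Definition csize (c : T -> 'I_3) (i : 'I_3) : R := \sum_u (c u == i)%:R.

(** On a triangle [x y z] the three vertices get colours 0, 1, 2. Colour 2 also takes the common
    neighbours of the triangle, called apexes below. *)
Definition tri_colour (x y u : T) : 'I_3 :=
  if ~~ a x u then @Ordinal 3 0 isT
  else if ~~ a y u then @Ordinal 3 1 isT else @Ordinal 3 2 isT.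

Hypotheses (a_sym : symmetric a) (a_irr : irreflexive a).

Lemma cocherry_isol x u v :
  ~~ a x u -> ~~ a x v -> a u v -> cocherry a x u v.
Proof.
move=> xu xv uv; rewrite /cocherry /nadj xu xv uv !andbT.
have [E|_] := eqVneq x u; first by rewrite E uv in xv.
have [E|_] := eqVneq x v; first by rewrite E a_sym uv in xu.
by rewrite !orbT.
Qed.

Lemma cocherry_r x u v :
  a x u -> ~~ a x v -> ~~ a u v -> cocherry a x u v.
Proof.
move=> xu xv uv; rewrite /cocherry /nadj xu xv uv !andbT.
have [E|_] := eqVneq x v; first by rewrite -E a_sym xu in uv.
by have [E|_] := eqVneq u v; first by rewrite -E xu in xv.
Qed.

Lemma cocherry_l x u v :
  ~~ a x u -> a x v -> ~~ a u v -> cocherry a x u v.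
Proof.
move=> xu xv uv; rewrite /cocherry /nadj xu xv uv !andbT.
have [E|_] := eqVneq x u; first by rewrite -E xv in uv.
have [E|_] := eqVneq u v; first by rewrite E xv in xu.
by rewrite orbT.
Qed.

Section Triangle.
Variables x y z : T.
Hypotheses (xy : a x y) (xz : a x z) (yz : a y z).

Definition apex u := [&& a x u, a y u & a z u].

(** A wrong pair with different colours, or with common colour 0 or 1, forms a cocherry with [x] or
    [y]. Two vertices of colour 2 that are not apexes both miss [z], so an edge between them forms a
    cocherry with [z]. *)
Lemma edited_apex u v : edited (tri_colour x y) u v ->
  [|| cocherry a x u v, cocherry a y u v, cocherry a z u v, apex u | apex v].
Proof.
rewrite /edited /tri_colour /apex.
case xu: (a x u); case xv: (a x v) => /=.
- case yu: (a y u); case yv: (a y v) => /=.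
  + case uv: (a u v) => // _.
    case zu: (a z u); first by rewrite ?orbT.
    case zv: (a z v); first by rewrite ?orbT.
    by rewrite (@cocherry_isol z) ?zu ?zv ?uv ?orbT.
  + case uv: (a u v) => // _.
    by rewrite (@cocherry_r y) ?yu ?yv ?uv ?orbT.
  + case uv: (a u v) => // _.
    by rewrite (@cocherry_l y) ?yu ?yv ?uv ?orbT.
  + case uv: (a u v) => // _.
    by rewrite (@cocherry_isol y) ?yu ?yv ?uv ?orbT.
- case: (a y u) => /=; case uv: (a u v) => // _;
  by rewrite (@cocherry_r x) ?xu ?xv ?uv ?orbT.
- case: (a y v) => /=; case uv: (a u v) => // _;
  by rewrite (@cocherry_l x) ?xu ?xv ?uv ?orbT.
- case uv: (a u v) => // _.
  by rewrite (@cocherry_isol x) ?xu ?xv ?uv ?orbT.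
Qed.

Local Notation n := (#|T|%:R : R).
Local Notation deg := (@deg R T a).
Local Notation s := (\sum_u (apex u)%:R : R).

Lemma edits_apex : edits (tri_colour x y) <=
  ccdeg R a x + ccdeg R a y + ccdeg R a z + 2 * n * s.
Proof.
apply: (@le_trans _ _ (\sum_u \sum_v ((cocherry a x u v)%:R
  + (cocherry a y u v)%:R + (cocherry a z u v)%:R
  + (apex u)%:R + (apex v)%:R))).
  apply: ler_sum => u _; apply: ler_sum => v _.
  have := @edited_apex u v; case: edited => [/(_ isT)|_]; last first.
    by rewrite !addr_ge0.
  by case: cocherry; case: cocherry; case: cocherry; case: apex; case: apex
    => //= _; lra.
have -> : 2 * n * s = \sum_u \sum_(v : T) (apex u)%:R + n * s.
  by rewrite exchange_big /= sum_const_r; ring.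
have -> : n * s = \sum_(u : T) \sum_v (apex v)%:R.
  by rewrite sum_const_r.
rewrite !addrA -!big_split /=; apply: ler_sum => u _.
by rewrite -!big_split.
Qed.

(** Checked vertex by vertex: a vertex seeing only one vertex of the triangle is in a cocherry with
    the opposite edge, one seeing none is in a cocherry with all three edges. For a typical triangle
    the degrees nearly cancel [2 n]. *)
Lemma apex_le :
  s <= deg x + deg y + deg z - 2 * n
       + (cccodeg R a x y + cccodeg R a y z + cccodeg R a x z).
Proof.
have E : forall u, 0 <= (a x u)%:R + (a y u)%:R + (a z u)%:R - 2 - (apex u)%:R
  + (cocherry a x y u)%:R + (cocherry a y z u)%:R + (cocherry a x z u)%:R :> R.
  move=> u; rewrite /apex.
  have H p q : a p q -> ~~ a p u -> ~~ a q u -> cocherry a p q u.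
    move=> pq pu qu; rewrite /cocherry /nadj pq pu qu !andbT.
    have [E|_] := eqVneq p u; first by rewrite -E a_sym pq in qu.
    by have [E|_] := eqVneq q u; first by rewrite -E pq in pu.
  have Hxy := H x y xy; have Hyz := H y z yz; have Hxz := H x z xz.
  move: Hxy Hyz Hxz.
  case: (a x u); case: (a y u); case: (a z u) => /= Hxy Hyz Hxz;
    rewrite ?(Hxy isT isT) ?(Hyz isT isT) ?(Hxz isT isT) /=;
    repeat match goal with |- context [nat_of_bool (cocherry ?a ?b ?c ?d)] =>
      have := ler0n R (nat_of_bool (cocherry a b c d));
      move: ((cocherry a b c d)%:R : R) => ? end; lra.
have := sumr_ge0 (index_enum T) (P := xpredT) (fun u _ => E u).
rewrite !big_split /= !sumrN sum_const_r /deg /cccodeg; lra.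
Qed.

(** For an apex [v] and a non-neighbour [w] of [v], either [w] is an apex, or it misses some
    triangle vertex [p] and the edge [p v] forms a cocherry with [w]. *)
Lemma apex_codeg : \sum_v (apex v)%:R * (n - deg v) <=
  s * s + (ccdeg R a x + ccdeg R a y + ccdeg R a z).
Proof.
rewrite mulr_suml -!big_split /=; apply: ler_sum => v _.
rewrite mulr_sumr -!big_split /=.
have -> : n - deg v = \sum_w (1 - (a v w)%:R).
  by rewrite sumrB sum_nat1.
rewrite mulr_sumr; apply: ler_sum => w _.
case av: (apex v); last by rewrite !mul0r add0r !addr_ge0.
rewrite !mul1r; case vw: (a v w); first by rewrite subrr !addr_ge0.
have [xv yv zv] := and3P av.
have H p : a p v -> ~~ a p w -> cocherry a p v w.
  by move=> ? ?; apply: cocherry_r; rewrite ?vw.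
have Hx := H x xv; have Hy := H y yv; have Hz := H z zv.
rewrite /apex; move: {H} Hx Hy Hz.
case: (a x w); case: (a y w); case: (a z w) => /=;
  case: cocherry; case: cocherry; case: cocherry => /= Hx Hy Hz;
  rewrite ?subr0; try lra;
  first [by have := Hx isT | by have := Hy isT | by have := Hz isT].
Qed.

End Triangle.
End Edits.

(** * Closeness to a balanced complete tripartite graph *)

Section NearTripartite.
Variables (R : realFieldType) (T : finType) (a : rel T).
Hypotheses (a_sym : symmetric a) (a_irr : irreflexive a).
Local Notation n := (#|T|%:R : R).
Local Notation deg := (@deg R T a).
Local Notation csize := (@csize T R).
Local Notation codeg := (@cccodeg R T a).

Lemma sum_csize c : \sum_i csize c i = n.
Proof.
rewrite /csize exchange_big /= -(sum_nat1 R T); apply: eq_bigr => u _.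
by under eq_bigr => i _ do rewrite eq_sym; rewrite sum_eq1.
Qed.

Lemma csize3 c : csize c (@Ordinal 3 0 isT) + csize c (@Ordinal 3 1 isT)
  + csize c (@Ordinal 3 2 isT) = n.
Proof.
rewrite -(sum_csize c) !big_ord_recl big_ord0 addr0 addrA.
by congr (csize c _ + csize c _ + csize c _); apply: val_inj.
Qed.

Lemma csize_tri0 x y : csize (tri_colour a x y) (@Ordinal 3 0 isT) = n - deg x.
Proof.
rewrite -(sum_nat1 R T) /deg -sumrB; apply: eq_bigr => u _.
by rewrite /tri_colour; case: (a x u); case: (a y u); rewrite /= ?subrr ?subr0.
Qed.

(** Class 1 is the set of non-neighbours of [y] adjacent to [x]; those not adjacent to [x] form
    cocherries with the edge [x y]. *)
Lemma csize_tri1 x y : a x y ->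
  n - deg y - codeg x y <= csize (tri_colour a x y) (@Ordinal 3 1 isT)
    <= n - deg y.
Proof.
move=> xy; rewrite -(sum_nat1 R T) /deg /cccodeg -!sumrB /csize.
apply/andP; split; apply: ler_sum => u _; rewrite /tri_colour; last first.
  by case: (a x u); case: (a y u); rewrite /=; lra.
have [|] := boolP (cocherry a x y u).
  by case: (a x u); case: (a y u); rewrite /=; lra.
case xu: (a x u); case yu: (a y u); rewrite /=; try lra.
rewrite /cocherry /nadj xy xu yu !andbT /=.
have [E|_] := eqVneq x u; first by rewrite -E a_sym xy in yu.
by have [E|_] := eqVneq y u; first by rewrite -E xy in xu.
Qed.

Lemma apex_ge x y z :
  (\sum_u (apex a x y z u)%:R) * n
  <= 4 * (\sum_u (apex a x y z u)%:R * (n - deg u))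
     + n * \sum_u (3 / 4 * n < deg u)%R%:R.
Proof.
rewrite mulr_suml mulr_sumr mulr_sumr -big_split; apply: ler_sum => u _ /=.
have := deg_le R a_irr u; have n0 : 0 <= n by exact: ler0n.
by case: (apex a x y z u); case: (ltrP (3 / 4 * n) (deg u)); rewrite /=; lra.
Qed.

Variable eta : R.
Hypotheses (eta0 : 0 < eta) (eta1 : eta <= 1 / 100) (eta6 : 72 <= eta * n).
Hypothesis Loss_small : Loss R a <= eta ^+ 3 / 6 * n ^+ 4.

(** Cocherries at the triangle account for all wrong pairs except those at the [s] apexes. A crude
    bound [s <= n / 8] is bootstrapped through [apex_codeg] to one of the order of the loss. *)
Theorem near_tripartite : exists c : T -> 'I_3,
  (forall i, `|csize c i - n / 3| <= 3 * eta * n) /\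
  n ^+ 2 * edits a R c <= 300 * 100 * Loss R a.
Proof.
have [x [y [z [gt cost]]]] :=
  good_triple_exists a_sym a_irr eta0 eta1 eta6 Loss_small.
have /and5P[tx ty tz xy /andP[xz yz]] := gt.
exists (tri_colour a x y).
have nb : 720 <= n.
  have : eta * n <= n / 100.
    by rewrite [leRHS]mulrC ler_wpM2r ?ler0n //; move: eta1; rewrite div1r.
  by move: eta6; lra.
have n0 : 0 < n by lra.
have En0 : 0 < eta * n by move: eta6; lra.
have Ls := Loss_small; set L := Loss R a in cost Ls *.
set q := ccdeg R a x + ccdeg R a y + ccdeg R a z.
set p := codeg x y + codeg y z + codeg x z.
have q0 : 0 <= q by rewrite !addr_ge0 ?ccdeg_ge0.
have p0 : 0 <= p by rewrite !addr_ge0 ?cccodeg_ge0.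
have {}cost : n ^+ 2 * q + n ^+ 3 * p <= 1445 * L.
  by move: cost; rewrite /tri_cost -/q -/p; lra.
(* Uses [1445 / 6 * (1 / 100)^2 < 1 / 40]. *)
have Hp : p <= eta * n / 40.
  have n3 : 0 < n ^+ 3 by exact: exprn_gt0.
  rewrite -(ler_pM2l n3); apply: (@le_trans _ _ (1445 * L)).
    by have := mulr_ge0 (ltW (exprn_gt0 2 n0)) q0; lra.
  have E2 : eta ^+ 2 <= (1 / 100) ^+ 2.
    by rewrite lerXn2r ?nnegrE //; move: eta0; lra.
  have := ler_wpM2l (ltW (mulr_gt0 n3 En0)) E2.
  by have := mulr_gt0 n3 En0; lra.
have etan : eta * n <= n / 100.
  by rewrite [leRHS]mulrC ler_wpM2r ?ler0n //; move: eta1; rewrite div1r.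
set s := \sum_u (apex a x y z u)%:R : R.
have s0 : 0 <= s by apply: sumr_ge0.
move: (tx) (ty) (tz); rewrite /typical !ler_norml.
move=> /andP[x1 x2] /andP[y1 y2] /andP[z1 z2].
have Hs : s <= n / 8.
  by have := apex_le R a_sym xy xz yz; rewrite -/s -/p; lra.
split.
  have p1 : codeg x y <= eta * n / 40.
    apply: le_trans Hp; rewrite /p -addrA lerDl addr_ge0 ?cccodeg_ge0 //.
  clear z1 z2 Ls cost Hp Hs q0 p0 s0 nb etan.
  have S3 := csize3 (tri_colour a x y).
  have S0 := csize_tri0 x y.
  have /andP[S1 S1'] := csize_tri1 xy.
  case=> [[|[|[|//]]] Hi]; rewrite (bool_irrelevance Hi isT) ler_norml;
    apply/andP; split; lra.
clear x1 x2 y1 y2 z1 z2 En0 Hp etan Ls.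
set B := \sum_u (3 / 4 * n < deg u)%R%:R : R.
(* Here [3/4 - 2/3 = 1/12] and [864 = 6 * 12^2]. *)
have HB : n ^+ 3 * B <= 864 * L.
  have := @Loss_far R T a a_irr (1 / 12) (fun u => 3 / 4 * n < deg u).
  rewrite -/L -/B => H.
  have {H} : (1 / 12) ^+ 2 * n ^+ 3 * B <= 6 * L.
    apply: H; [lra|lra|lra|move=> u Hu].
    by rewrite ler_normr; apply/orP; left; lra.
  by lra.
have H1 : s * n <= 4 * (s * s + q) + n * B.
  have := apex_ge x y z; rewrite -/s -/B.
  have := apex_codeg R a_sym x y z; rewrite -/s -/q.
  by lra.
(* The bootstrap: by [s <= n / 8] the term [4 s^2] is at most half of the left side. *)
have H2 : s * n <= 8 * q + 2 * n * B.
  by have := ler_wpM2l s0 Hs; lra.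
have H3 : edits a R (tri_colour a x y) <= 17 * q + 4 * n * B.
  by have := edits_apex R a_sym x y z; rewrite -/s -/q; lra.
apply: le_trans (ler_wpM2l (ltW (exprn_gt0 2 n0)) H3) _.
have L0 : 0 <= L.
  have n2 : 2 <= n by lra.
  by have := Loss_ge a_irr n2; have := exprn_gt0 2 n0; rewrite -/L; lra.
(* Altogether [17 * 1445 + 4 * 864], which is below [300 * 100]. *)
have := mulr_ge0 (ltW (exprn_gt0 3 n0)) p0; lra.
Qed.


End NearTripartite.

(** * Complete tripartite graphs *)

Definition blow (T : finType) (c : T -> 'I_3) : rel T :=
  fun u v => c u != c v.

Section Blow.
Variables (R : realFieldType) (T : finType) (c : T -> 'I_3).
Local Notation n := (#|T|%:R : R).

Lemma blow_sym : symmetric (blow c).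
Proof. by move=> u v; rewrite /blow eq_sym. Qed.

Lemma blow_irr : irreflexive (blow c).
Proof. by move=> u; rewrite /blow eqxx. Qed.

Lemma deg_blow u : deg R (blow c) u = n - csize R c (c u).
Proof.
rewrite -(sum_nat1 R T) /deg -sumrB; apply: eq_bigr => v _.
by rewrite /blow eq_sym; case: eqP; rewrite /= ?subrr ?subr0.
Qed.

Lemma cot_blow u : cot R (blow c) u = 0.
Proof.
rewrite /cot big1 // => v _; rewrite big1 // => w _; rewrite /nadj /blow !negbK.
case: (eqVneq (c u) (c v)) => [->|_]; last by rewrite andbF.
by case: (eqVneq (c v) (c w)); rewrite ?andbF.
Qed.

Lemma Loss_blow : 1 <= n -> (forall i, `|csize R c i - n / 3| <= 1) ->
  Loss R (blow c) <= 3 * n ^+ 2.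
Proof.
move=> n1 H; rewrite LossE; last exact: blow_irr.
have -> : 3 * n ^+ 2 = \sum_(u : T) 3 * n by rewrite sum_const_r; ring.
apply: ler_sum => u _; rewrite loss_split cot_blow mulr0 addr0.
have -> : deg R (blow c) u = 2 / 3 * n + (n / 3 - csize R c (c u)).
  by rewrite deg_blow; field.
by rewrite cap_sub; apply: capsub_le => //; rewrite distrC.
Qed.
End Blow.

(** * Stability near a complete tripartite graph *)

Section Local.
Variables (R : realFieldType) (T : finType) (a : rel T) (c : T -> 'I_3).
Hypotheses (a_sym : symmetric a) (a_irr : irreflexive a).
Local Notation n := (#|T|%:R : R).
Local Notation degb := (@deg R T (blow c)).
Local Notation deg := (@deg R T a).
Local Notation csize := (csize R c).
Local Notation r u := (\sum_v (edited a c u v)%:R : R).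
Local Notation D := (edits a R c).

Lemma edits_at_le u : r u <= D.
Proof.
rewrite /edits [leRHS](bigD1 u) //= lerDl.
by apply: sumr_ge0 => v _; exact: sumr_ge0.
Qed.

Lemma deg_edits u : `|degb u - deg u| <= r u.
Proof.
rewrite /deg -sumrB; apply: le_trans (ler_norm_sum _ _ _) _.
apply: ler_sum => v _; rewrite /edited /blow.
by case: (a u v); case: (c u != c v);
  rewrite /= ?subrr ?normr0 ?subr0 ?sub0r ?normrN ?normr1.
Qed.

(** Any [z] in the class of [x], other than [x] and [y], with [x z] and [y z] both unedited forms a
    cocherry with the wrong pair: the edge is [x y] if the colours agree and [y z] otherwise. *)
Lemma cccodeg_edited x y : edited a c x y ->
  csize (c x) - r x - r y - 2 <= cccodeg R a x y.
Proof.
move=> xy.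
have -> : csize (c x) - r x - r y - 2 =
  \sum_z ((c z == c x)%:R - (edited a c x z)%:R - (edited a c y z)%:R
   - (z == x)%:R - (z == y)%:R).
  by rewrite !big_split /= !sumrN !sum_eq1 /csize; ring.
apply: ler_sum => z _; have := ler0n R (cocherry a x y z).
case: (eqVneq z x) => [_|zx].
  by case: (c z == c x); case: (z == y);
    case: (edited a c x z); case: (edited a c y z); rewrite /=; lra.
case: (eqVneq z y) => [_|zy].
  by case: (c z == c x); case: (edited a c x z); case: (edited a c y z); rewrite /=; lra.
case: (eqVneq (c z) (c x)) => [zxc|_]; last first.
  by case: (edited a c x z); case: (edited a c y z); rewrite /=; lra.
case exz: (edited a c x z); first by case: (edited a c y z); rewrite /=; lra.
case eyz: (edited a c y z); first by rewrite /=; lra.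
suff -> : cocherry a x y z by rewrite /=; lra.
move: xy exz eyz; rewrite /edited /cocherry /nadj zxc eqxx /=.
rewrite !(eq_sym _ z) zx zy /=.
have [->|xyn] := eqVneq x y; first by rewrite a_irr eqxx.
rewrite (eq_sym (c y)).
by case: (a x y); case: (a x z); case: (a y z); case: (c x == c y).
Qed.

Hypotheses (n1000 : 1000 <= n)
  (sizes : forall i, `|csize i - n / 3| <= 3 / 1000 * n)
  (D_small : D <= n / 1000).

Lemma cc_edits : n / 4 * D <= \sum_x ccdeg R a x.
Proof.
rewrite /edits mulr_sumr; apply: ler_sum => x _.
rewrite /ccdeg mulr_sumr; apply: ler_sum => y _.
case xy: (edited a c x y); last by rewrite mulr0 sumr_ge0.
rewrite mulr1; apply: le_trans (cccodeg_edited xy).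
have := edits_at_le x; have := edits_at_le y; have := sizes (c x); rewrite ler_norml.
by move: n1000 D_small; lra.
Qed.

(** The cubic is almost flat near its maximum at [2 n / 3], so changing the degree by [r u] costs
    only a small multiple of [n^2 * r u]. *)
Lemma cap_edits u :
  (n - 1 - deg u) * deg u * (deg u - 1)
  - n ^+ 2 / 48 * r u <= (n - 1 - degb u) * degb u * (degb u - 1).
Proof.
have d := deg_edits u; have ru := edits_at_le u; have := sizes (c u).
set e := deg u - 2 / 3 * n; set e' := degb u - 2 / 3 * n.
have dE : deg u = 2 / 3 * n + e by rewrite /e; ring.
have dE' : degb u = 2 / 3 * n + e' by rewrite /e'; ring.
have -> : csize (c u) - n / 3 = - e' by rewrite /e' deg_blow; field.
rewrite normrN ler_norml => /andP[l1 u1].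
have De : `|e' - e| <= r u.
  by apply: le_trans d; rewrite /e /e' opprB addrA subrK.
have := @cap_sub R n e; have := @cap_sub R n e'; rewrite -dE -dE' => E' E.
(* The divided difference of the cubic in [cap_sub] between [e] and [e']. *)
set S := n - 1 + n * (e + e') + (e ^+ 2 + e * e' + e' ^+ 2).
have HS : `|S| <= n ^+ 2 / 48.
  have : `|e' - e| <= n / 1000 by move: D_small; lra.
  rewrite ler_norml => /andP[l2 u2].
  clear d ru De dE dE' E E'.
  have n0 : 0 <= n by move: n1000; lra.
  have l3 : - (n / 250) <= e by lra.
  have u3 : e <= n / 250 by lra.
  have s3 : `|e + e'| <= n / 100 by rewrite ler_norml; apply/andP; split; lra.
  have A : `|n * (e + e')| <= n * (n / 100).
    by rewrite normrM (ger0_norm n0) ler_wpM2l.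
  have B0 : 0 <= e ^+ 2 + e * e' + e' ^+ 2.
    by have := sqr_ge0 (e + e'); have := sqr_ge0 e; have := sqr_ge0 e'; lra.
  have B : e ^+ 2 + e * e' + e' ^+ 2 <= 3 * (n / 250) ^+ 2.
    have sq x : - (n / 250) <= x -> x <= n / 250 -> x ^+ 2 <= (n / 250) ^+ 2.
      by move=> ? ?; rewrite -subr_ge0 subr_sqr; apply: mulr_ge0; lra.
    have := sq e l3 u3; have := sq e'.
    have -> : - (n / 250) <= e' by lra.
    have -> : e' <= n / 250 by lra.
    move=> /(_ isT isT).
    by have := sqr_ge0 (e - e'); lra.
  clear l1 u1 l2 u2 l3 u3 s3.
  have N : 1000 * n <= n * n by rewrite ler_wpM2r.
  move: A; rewrite !ler_norml /S => /andP[A1 A2].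
  by apply/andP; split; move: n1000; lra.
have : `|(e' - e) * S| <= r u * (n ^+ 2 / 48).
  by rewrite normrM ler_pM.
by rewrite ler_norml /S => /andP[_]; lra.
Qed.

Lemma local_stability : n ^+ 2 * D <= 48 * (Lam R (blow c) - Lam R a).
Proof.
have blow_sym := @blow_sym T c; have blow_irr := @blow_irr T c.
rewrite !LamE //.
have n0 : 0 <= n by move: n1000; lra.
have Q := cc_edits; rewrite ccdegE // in Q.
(* By [cc_edits] the cocherries bring at least [n^2 / 24 * D], of which the degree changes can take
   back at most half. *)
have : \sum_u (n / 2 * cot R a u - n ^+ 2 / 48 * r u) <=
  \sum_u ((degb u - 1) * ((n - 1 - degb u) * degb u - cot R (blow c) u)
    - (deg u - 1) * ((n - 1 - deg u) * deg u - cot R a u)).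
  apply: ler_sum => u _; rewrite cot_blow subr0.
  have c0 := cot_ge0 R a u.
  have : n / 2 * cot R a u <= (deg u - 1) * cot R a u.
    rewrite ler_wpM2r //.
    have := deg_edits u; have := edits_at_le u; have := sizes (c u).
    by rewrite deg_blow !ler_norml; move: n1000 D_small; lra.
  by have := cap_edits u; lra.
rewrite !sumrB -!mulr_sumr -/D.
move: Q; set C := \sum_x cot R a x => Q H.
have := ler_wpM2l n0 Q; rewrite /edits in H *; lra.
Qed.

End Local.

(** * The balanced colouring *)

Definition balanced (T : finType) (u : T) : 'I_3 := inord (enum_rank u %% 3).

Lemma sum_modn3 m i : (i < 3)%N ->
  (\sum_(k < m) (k %% 3 == i) = (m + 2 - i) %/ 3)%N.
Proof.
move=> i3; elim: m => [|m IH]; first by rewrite big_ord0; lia.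
rewrite big_ord_recr /= IH; case: eqP; lia.
Qed.

Lemma csize_balanced (R : realFieldType) (T : finType) i :
  `|csize R (@balanced T) i - #|T|%:R / 3| <= 1.
Proof.
have -> : csize R (@balanced T) i = ((#|T| + 2 - i) %/ 3)%:R.
  rewrite -sum_modn3 ?ltn_ord // /csize natr_sum.
  rewrite (reindex (@enum_val T T)) /=; last first.
    apply: onW_bij.
    by exists (@enum_rank T); [exact: enum_valK|exact: enum_rankK].
  apply: eq_bigr => k _; rewrite /balanced enum_valK -val_eqE /= inordK //.
  by rewrite ltn_mod.
have i3 := ltn_ord i.
have H1 : (3 * ((#|T| + 2 - i) %/ 3) <= #|T| + 2)%N by lia.
have H2 : (#|T| <= 3 * ((#|T| + 2 - i) %/ 3) + 2)%N by lia.
move: H1 H2; move: (_ %/ 3)%N => k; move: #|T| => m.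
rewrite -!(ler_nat R) !natrD ler_norml => H1 H2.
by apply/andP; split; lra.
Qed.

(** * Perfect stability in terms of [Lam] *)

Section Core.
Variable R : realFieldType.

Lemma edits_le (T : finType) (a : rel T) c : edits a R c <= #|T|%:R ^+ 2.
Proof.
have -> : #|T|%:R ^+ 2 = \sum_(u : T) \sum_(v : T) 1 :> R.
  by rewrite !sum_const_r; ring.
by apply: ler_sum => u _; apply: ler_sum => v _; case: edited; rewrite ?ler01.
Qed.

Lemma edits_ge0 (T : finType) (a : rel T) c : 0 <= edits a R c.
Proof. by apply: sumr_ge0 => u _; apply: sumr_ge0. Qed.

Lemma Lam_le (T : finType) (a : rel T) : irreflexive a ->
  2 <= #|T|%:R :> R -> Lam R a <= #|T|%:R * cap #|T|%:R.
Proof.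
move=> a_irr n2; rewrite -subr_ge0 -/(Loss R a).
by have := Loss_ge a_irr n2; have := sqr_ge0 (#|T|%:R : R); lra.
Qed.

Lemma Lam_balanced (T : finType) : 1 <= #|T|%:R :> R ->
  #|T|%:R * cap #|T|%:R - 3 * #|T|%:R ^+ 2 <= Lam R (blow (@balanced T)).
Proof.
move=> n1; have := Loss_blow n1 (csize_balanced R T).
by rewrite /Loss; lra.
Qed.

(* Either [M - Lam a] is of order [n^4] and there is nothing to prove, or
   [near_tripartite] gives [edits <= C (1 + (M - Lam a) / n^2)]; the additive
   constant is absorbed when there are many edits, and [local_stability]
   handles a bounded number of edits. *)
Theorem perfect_stability_Lam : exists C : R, 4 <= C /\
  forall (T : finType) (a : rel T) (M : R), symmetric a -> irreflexive a ->
  C <= #|T|%:R -> (forall c : T -> 'I_3, Lam R (blow c) <= M) ->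
  exists c, #|T|%:R ^+ 2 * edits a R c <= C * (M - Lam R a).
Proof.
(* Twice [6 / eta^3] for [eta = 1 / 1000]: if [C * X < n^4], then [X] uses at most half of the loss
   allowed in [near_tripartite], leaving room for [3 n^2]. *)
exists (12 * 1000 * 1000 * 1000); split; first by lra.
move=> T a M a_sym a_irr; set n := #|T|%:R => nC HM.
have n0 : 0 < n by lra.
have n2 : 0 < n ^+ 2 by exact: exprn_gt0.
have n3 : 0 < n ^+ 3 by exact: exprn_gt0.
have n4 : 0 < n ^+ 4 by exact: exprn_gt0.
set X := M - Lam R a.
have [Xbig|Xsmall] := lerP (n ^+ 4) (12 * 1000 * 1000 * 1000 * X).
  exists (@balanced T); apply: le_trans Xbig.
  have -> : n ^+ 4 = n ^+ 2 * n ^+ 2 by ring.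
  by rewrite ler_pM2l // edits_le.
have MF : n * cap n - 3 * n ^+ 2 <= M.
  by apply: le_trans (HM (@balanced T)); apply: Lam_balanced; lra.
have N2 : 1000 * 1000 * 1000 * 1000 * n ^+ 2 <= n ^+ 4.
  have -> : n ^+ 4 = n * n * n ^+ 2 by ring.
  rewrite ler_pM2r //; apply: (@le_trans _ _ (n * 1000)); first by lra.
  by rewrite ler_pM2l //; lra.
have Ls : Loss R a <= (1 / 1000) ^+ 3 / 6 * n ^+ 4.
  by rewrite /Loss -/n; move: MF Xsmall N2; rewrite /X; lra.
have [||| c [sz ed]] := @near_tripartite R T a a_sym a_irr (1 / 1000) _ _ _ Ls.
- by lra.
- by lra.
- by rewrite -/n; lra.
exists c; move: ed; rewrite -/n.
have LX : Loss R a <= 3 * n ^+ 2 + X by rewrite /Loss /X -/n; lra.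
clear Xsmall MF N2 Ls n3 n4.
(* The additive term is [30000 * 3 n^2]; from twice that number of edits on it is at most half of
   [n^2] times the edits. *)
have [Dbig|Dsmall] := lerP (180 * 1000) (edits a R c) => ed.
  have := ler_wpM2l (ltW n2) Dbig.
  have D0 := edits_ge0 a c.
  have := mulr_ge0 (ltW n2) D0; lra.
have Ln : 1000 <= n by lra.
have := @local_stability R T a c a_sym a_irr Ln _ _.
rewrite -/n => H.
have {}H : n ^+ 2 * edits a R c <= 48 * (Lam R (blow c) - Lam R a).
  apply: H; last by lra.
  by move=> i; apply: le_trans (sz i) _; rewrite -/n; lra.
have := HM c; have := mulr_ge0 (ltW n2) (edits_ge0 a c); rewrite /X; lra.
Qed.
End Core.

(** * From relations to graphs and edit distance *)

Lemma bigminn_le (I : finType) (k : nat) (P : pred I) (F : I -> nat) j : P j ->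
  (\big[minn/k]_(i | P i) F i <= F j)%N.
Proof.
move=> Pj; have := mem_index_enum j.
elim: (index_enum I) => //= i s IH; rewrite inE big_cons.
case/orP=> [/eqP <-|/IH H]; first by rewrite Pj geq_minl.
by case: ifP => // _; apply: leq_trans (geq_minr _ _) H.
Qed.

Section Graphs.
Variable T : finType.
Implicit Types G : sgraph T.

Lemma edge_card G e : e \in edges G -> #|e| = 2%N.
Proof. by move=> eG; apply/eqP; have /'forall_implyP := edgesP G; apply. Qed.

Lemma adj_sym G : symmetric (adj G).
Proof. by move=> u v; rewrite /adj finset.setUC. Qed.

Lemma adj_irr G : irreflexive (adj G).
Proof.
move=> u; rewrite /adj finset.setUid; apply/negP => /edge_card.
by rewrite cards1.
Qed.

Lemma adj_of_rel (r : rel T) : symmetric r -> irreflexive r ->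
  adj (sgraph_of_rel r) =2 r.
Proof.
move=> r_sym r_irr u v; rewrite /adj inE.
apply/andP/idP => [[_ /existsP[x /existsP[y /andP[/eqP E rxy]]]]|ruv].
  have xy : x != y by apply: contraTneq rxy => ->; rewrite r_irr.
  have : x \in [set u; v] by rewrite E !inE eqxx.
  have : y \in [set u; v] by rewrite E !inE eqxx orbT.
  rewrite !inE => /orP[] /eqP Ey /orP[] /eqP Ex; subst x y => //.
  - by rewrite eqxx in xy.
  - by rewrite r_sym.
  - by rewrite eqxx in xy.
have uv : u != v by apply: contraTneq ruv => ->; rewrite r_irr.
split; first by rewrite cards2 uv.
by apply/existsP; exists u; apply/existsP; exists v; rewrite eqxx.
Qed.

Definition colour_class (c : T -> 'I_3) (i : 'I_3) : {set T} :=
  [set u | c u == i].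

Lemma colour_class_parts c : is_parts (colour_class c).
Proof.
split=> [|i j ij].
  apply/setP => u; rewrite inE; apply/bigcupP; exists (c u) => //.
  by rewrite inE.
rewrite disjoint_subset; apply/fintype.subsetP => u; rewrite !inE => /eqP ->.
by [].
Qed.

Lemma adj_complete m : adj (complete 'I_m) =2 (fun i j => i != j).
Proof. by move=> i j; rewrite /adj inE andbT cards2; case: (i == j). Qed.

Lemma adj_blowup c : adj (blowup (complete 'I_3) (colour_class c)) =2 blow c.
Proof.
have E : forall x y, [exists i, exists j, [&& x \in colour_class c i,
    y \in colour_class c j & adj (complete 'I_3) i j]] = blow c x y.
  move=> x y; apply/existsP/idP => [[i /existsP[j]]|xy].
    by rewrite !inE adj_complete => /and3P[/eqP <- /eqP <-].
  exists (c x); apply/existsP; exists (c y); rewrite !inE !eqxx /=.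
  by rewrite adj_complete.
move=> u v; rewrite adj_of_rel ?E // => [x y|x]; rewrite !E.
  exact: blow_sym.
exact: blow_irr.
Qed.

Lemma sum_pairs_set2 (e : {set T}) : #|e| = 2%N ->
  (\sum_u \sum_v ([set u; v] == e) = 2)%N.
Proof.
move=> /eqP/cards2P[x [y [xy ->]]].
have S u : (\sum_v ([set u; v] == [set x; y]) = (u == x) + (u == y))%N.
  have H v : ([set u; v] == [set x; y]) =
    ((u == x) && (v == y)) || ((u == y) && (v == x)).
    apply/eqP/idP => [E|/orP[] /andP[/eqP-> /eqP->] //]; last first.
      by rewrite finset.setUC.
    have : x \in [set u; v] by rewrite E !inE eqxx.
    have : y \in [set u; v] by rewrite E !inE eqxx orbT.
    rewrite !inE => /orP[] /eqP Ey /orP[] /eqP Ex; subst x y => //;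
      rewrite ?eqxx ?orbT // in xy *.
  have Ssum z : (\sum_v (v == z) = 1)%N.
    by rewrite (bigD1 z) //= eqxx big1 // => w /negPf ->.
  rewrite (eq_bigr (fun v => (u == x) * (v == y) + (u == y) * (v == x))%N).
    by rewrite big_split /= -!big_distrr /= !Ssum !muln1.
  move=> v _; rewrite H; have [->|_] := eqVneq u x.
    by rewrite (negPf xy) orbF mul1n mul0n addn0.
  by rewrite mul0n add0n mulnb.
rewrite (eq_bigr _ (fun u _ => S u)) big_split /=.
have Ssum z : (\sum_v (v == z) = 1)%N.
  by rewrite (bigD1 z) //= eqxx big1 // => w /negPf ->.
by rewrite !Ssum.
Qed.

Lemma sum_pairs_edges (S : {set {set T}}) : (forall e, e \in S -> #|e| = 2%N) ->
  (\sum_u \sum_v ([set u; v] \in S) = 2 * #|S|)%N.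
Proof.
move=> S2.
have E u v : ([set u; v] \in S : nat) = (\sum_(e in S) ([set u; v] == e))%N.
  case uvS: (_ \in S).
    rewrite (bigD1 [set u; v]) //= eqxx big1 // => e /andP[_].
    by rewrite eq_sym => /negPf ->.
  rewrite big1 // => e eS; case: eqP => // E; by rewrite E eS in uvS.
under eq_bigr => u _ do under eq_bigr => v _ do rewrite E.
under eq_bigr => u _ do rewrite exchange_big /=.
rewrite exchange_big /= (eq_bigr (fun=> 2%N)) => [|e /S2/sum_pairs_set2 //].
by rewrite sum_nat_const mulnC.
Qed.

(** The factor 2 arises because [edits] runs over ordered pairs. *)
Lemma edits_symdiff (R : realFieldType) G c :
  edits (adj G) R c = 2 * #|symdiff (edges G)
    (edges (blowup (complete 'I_3) (colour_class c)))|%:R.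
Proof.
set G' := blowup _ _.
have S2 : forall e, e \in symdiff (edges G) (edges G') -> #|e| = 2%N.
  move=> e; rewrite finset.in_setU !finset.in_setD.
  by move=> /orP[] /andP[_] /edge_card.
have := congr1 (fun k => k%:R : R) (sum_pairs_edges S2); rewrite natrM => <-.
rewrite natr_sum; apply: eq_bigr => u _; rewrite natr_sum.
apply: eq_bigr => v _; congr (nat_of_bool _)%:R.
rewrite /edited -[c u != c v]/(blow c u v) -adj_blowup -/G' /adj.
rewrite finset.in_setU !finset.in_setD.
by case: (_ \in edges G); case: (_ \in edges G').
Qed.

(** The identity is an admissible bijection. *)
Lemma edit_distance_le G G' :
  (edit_distance G G' <= #|symdiff (edges G) (edges G')|)%N.
Proof.
rewrite /edit_distance.
have -> : #|symdiff (edges G) (edges G')| =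
    #|symdiff [set [ffun x : T => x] @: e | e : {set T} in edges G] (edges G')|.
  congr #|symdiff _ _|; rewrite -[LHS]finset.imset_id; apply: eq_imset => e.
  by rewrite -[LHS]finset.imset_id; apply: eq_imset => x; rewrite ffunE.
apply: (@bigminn_le _ _ _ _ [ffun x : T => x]).
apply/andP; split; first by apply/injectiveP => x y; rewrite !ffunE.
by apply/forallP => y; apply/codomP; exists y; rewrite ffunE.
Qed.

End Graphs.

(** * Embeddings of [H4] as quadruples *)

Section Embeddings.
Variable T : finType.
Implicit Types G : sgraph T.
Local Notation v k := (@Ordinal 4 k isT).

(** The last two coordinates are swapped because [Lam] sums over the images in the order 0, 1, 3,
    2. *)
Definition ffun4 (p : T * T * T * T) : {ffun 'I_4 -> T} :=
  [ffun i : 'I_4 => nth p.1.1.1 [:: p.1.1.1; p.1.1.2; p.2; p.1.2] i].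

Lemma ffun4_bij : bijective ffun4.
Proof.
exists (fun f : {ffun 'I_4 -> T} => (f (v 0), f (v 1), f (v 3), f (v 2))).
  by move=> [[[u w] x] y]; rewrite !ffunE.
move=> f; apply/ffunP; case=> [[|[|[|[|//]]]] Hi]; rewrite ffunE /=;
  by congr (f _); apply: val_inj.
Qed.

Lemma sum_pair4 (R : realFieldType) (F : T -> T -> T -> T -> R) :
  \sum_u \sum_w \sum_x \sum_y F u w x y =
  \sum_p F p.1.1.1 p.1.1.2 p.1.2 p.2.
Proof. by rewrite pair_bigA pair_bigA pair_bigA. Qed.

(** Adjacency to the image of 0 separates the images of 1 and 2; only those of 2 and 3 need an
    explicit inequality. *)
Lemma is_embedding_H4 G (f : {ffun 'I_4 -> T}) : is_embedding H4 G f =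
  [&& nadj (adj G) (f (v 0)) (f (v 1)), adj G (f (v 0)) (f (v 3)),
      adj G (f (v 1)) (f (v 3)), adj G (f (v 0)) (f (v 2)) &
      f (v 2) != f (v 3)].
Proof.
have im2 i j : f @: [set i; j] = [set f i; f j] by rewrite imsetU1 imset_set1.
rewrite /nadj /adj /is_embedding /=.
apply/and3P/and5P
  => [[/injectiveP f_inj redG blueG]|[/andP[n01 b01] r03 r13 r02 n23]].
  have E i j : [set i; j] \in edges (red H4) -> [set f i; f j] \in edges G.
    by move=> ij; have /'forall_implyP/(_ _ ij) := redG; rewrite im2.
  have B : [set f (v 0); f (v 1)] \notin edges G.
    rewrite -im2; have /'forall_implyP := blueG; apply.
    by rewrite finset.inE.
  have I i j : i != j -> f i != f j.
    by move=> ij; apply: contra ij => /eqP/f_inj ->.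
  by split; rewrite ?I ?B ?E // ?finset.inE ?eqxx ?orbT //.
have rel_neq i j : [set f i; f j] \in edges G -> f i != f j.
  move=> e; apply: contraTneq e => ->; rewrite finset.setUid.
  by apply/negP => /edge_card; rewrite cards1.
have n12 : f (v 1) != f (v 2).
  by apply: contraNneq b01 => ->.
split.
- apply/injectiveP => i j fij; apply/eqP; apply: contraTT isT => ij.
  have n02 := rel_neq _ _ r02; have n03 := rel_neq _ _ r03.
  have n13 := rel_neq _ _ r13.
  have neqE := (negPf n01, negPf n02, negPf n03, negPf n12, negPf n13,
    negPf n23).
  move: ij fij; case: i => [[|[|[|[|//]]]] Hi];
  case: j => [[|[|[|[|//]]]] Hj] //;
  rewrite (bool_irrelevance Hi isT) (bool_irrelevance Hj isT) => _ /eqP;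
  by rewrite ?neqE // eq_sym ?neqE.
- apply/'forall_implyP => e; rewrite !finset.inE.
  by move=> /orP[/orP[]|] /eqP ->; rewrite im2.
- by apply/'forall_implyP => e; rewrite !finset.inE => /eqP ->; rewrite im2.
Qed.

Lemma num_embeddings_H4 (R : realFieldType) G :
  (num_embeddings H4 G)%:R = Lam R (adj G).
Proof.
rewrite /num_embeddings -sum1_card natr_sum big_mkcond /=.
rewrite (reindex ffun4) /=; last exact: onW_bij ffun4_bij.
rewrite /Lam sum_pair4; apply: eq_bigr => [[[[u w] x] y]] _.
rewrite finset.inE is_embedding_H4 !ffunE /=.
by case: [&& _, _, _, _ & _].
Qed.
End Embeddings.

(** Needed because [max_density] ranges over graphs on ordinals only. *)
Lemma Lam_enum (R : realFieldType) (T : finType) (a : rel T) :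
  Lam R a = Lam R (fun i j : 'I_#|T| => a (enum_val i) (enum_val j)).
Proof.
have bij : {on [pred _ | true], bijective (@enum_val T T)}.
  apply: onW_bij.
  by exists (@enum_rank T); [exact: enum_valK|exact: enum_rankK].
rewrite /Lam (reindex _ bij) /=; apply: eq_bigr => i _.
rewrite (reindex _ bij) /=; apply: eq_bigr => j _.
rewrite (reindex _ bij) /=; apply: eq_bigr => k _.
rewrite (reindex _ bij) /=; apply: eq_bigr => l _.
by rewrite /nadj !(inj_eq enum_val_inj).
Qed.

Lemma eq_Lam (R : realFieldType) (T : finType) (a b : rel T) :
  a =2 b -> Lam R a = Lam R b.
Proof.
move=> ab; rewrite /Lam; do 4!(apply: eq_bigr => ? _).
by rewrite /nadj !ab.
Qed.

Lemma ffact4 (R : realFieldType) n :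
  (n ^_ 4)%:R = n%:R * (n%:R - 1) * (n%:R - 2) * (n%:R - 3) :> R.
Proof.
case: n => [|[|[|n]]]; rewrite ?ffactnS ?ffactn0 ?mul0r //=; by ring.
Qed.

(** * Densities *)

Section Density.
Variable R : realType.

Lemma densityE (T : finType) (G : sgraph T) :
  density R H4 G = Lam R (adj G) / (#|T| ^_ 4)%:R.
Proof. by rewrite /density num_embeddings_H4 card_ord. Qed.

Lemma density_max n (G : sgraph 'I_n) : density R H4 G <= max_density R H4 n.
Proof. exact: le_bigmax. Qed.

(** Supplies the bound [M] of [perfect_stability_Lam]. *)
Lemma Lam_blow_max (T : finType) (c : T -> 'I_3) : (4 <= #|T|)%N ->
  Lam R (blow c) <= max_density R H4 #|T| * (#|T| ^_ 4)%:R.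
Proof.
move=> T4; have f0 : 0 < (#|T| ^_ 4)%:R :> R by rewrite ltr0n ffact_gt0.
rewrite -ler_pdivrMr // Lam_enum.
pose c' (i : 'I_#|T|) := c (enum_val i).
apply: le_trans (density_max (blowup (complete 'I_3) (colour_class c'))).
rewrite densityE (eq_Lam _ (adj_blowup c')) card_ord.
by [].
Qed.
End Density.

(** * The limit and the two stability statements *)

Section Limit.
Variable R : realType.

(** The cubic terms are [- 2/3 n^3] in [n * cap n] and [- 8/9 n^3] in [4/27] of the falling
    factorial, so the difference, about [2/9 n^3], lies between [3 n^2] and [n^3]. *)
Lemma ncap_ffact n : (100 <= n)%N ->
  [/\ n%:R * cap n%:R <= 4 / 27 * (n ^_ 4)%:R + n%:R ^+ 3 :> R,
      4 / 27 * (n ^_ 4)%:R <= n%:R * cap n%:R - 3 * n%:R ^+ 2 :> R &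
      n%:R ^+ 4 <= 2 * (n ^_ 4)%:R :> R].
Proof.
rewrite ffact4 -(ler_nat R); move: (n%:R : R) => x x100.
have x0 : 0 < x by lra.
have x2 : 100 * x <= x ^+ 2 by rewrite expr2 ler_pM2r.
have x3 : 100 * x ^+ 2 <= x ^+ 3 by rewrite (exprS x 2) ler_pM2r // exprn_gt0.
have x4 : 100 * x ^+ 3 <= x ^+ 4 by rewrite (exprS x 3) ler_pM2r // exprn_gt0.
by rewrite /cap; split; lra.
Qed.

Lemma ffact4_le n : (n ^_ 4)%:R <= n%:R ^+ 4 :> R.
Proof.
have H k : (n - k <= n)%N by exact: leq_subr.
rewrite -natrX ler_nat !ffactnSr ffactn0 mul1n subn0 !expnS expn0 muln1 !mulnA.
by rewrite !leq_mul ?H.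
Qed.

Lemma binR2 n : 'C(n, 2)%:R = n%:R * (n%:R - 1) / 2 :> R.
Proof.
case: n => [|n]; first by rewrite bin0n !mul0r.
have := congr1 (fun k => k%:R : R) (bin_ffact n.+1 2).
rewrite ffactnS ffactn1 /= !natrM => E.
by rewrite -[in n.+1%:R - 1]natr1 addrK -E mulfK ?pnatr_eq0.
Qed.

(** Below, the balanced tripartite graph; above, nonnegativity of the loss, with error
    [n^3 = n^4 / n]. *)
Lemma max_density_bounds n : (100 <= n)%N ->
  4 / 27 <= max_density R H4 n <= 4 / 27 + 2 / n%:R.
Proof.
move=> n100; have [up low low4] := ncap_ffact n100.
have n4 : (4 <= n)%N by apply: leq_trans n100.
have f0 : 0 < (n ^_ 4)%:R :> R by rewrite ltr0n ffact_gt0.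
have nr : 100 <= n%:R :> R by rewrite ler_nat.
apply/andP; split.
  rewrite -(ler_pM2r f0); apply: le_trans low _.
  have := @Lam_balanced R 'I_n; have := @Lam_blow_max R 'I_n (@balanced 'I_n).
  rewrite card_ord => H1 H2; apply: le_trans (H1 n4); apply: H2; lra.
apply: bigmax_le => [|G _]; first by rewrite addr_ge0 ?divr_ge0.
rewrite densityE card_ord ler_pdivrMr //.
have := @Lam_le R 'I_n (adj G) (adj_irr G); rewrite card_ord => H.
apply: le_trans (H _) _; first lra.
apply: le_trans up _; rewrite [leRHS]mulrDl lerD2l.
have -> : n%:R ^+ 3 = n%:R ^+ 4 / n%:R :> R by field; rewrite gt_eqF; lra.
rewrite ler_pdivrMr; last lra.
apply: le_trans low4 _; rewrite mulrAC divfK //; lra.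
Qed.

Lemma cvg_max_density : (max_density R H4 @ \oo --> (4 / 27 : R))%classic.
Proof.
apply/cvgrPdist_le => e e0; near=> n.
have n100 : (100 <= n)%N by near: n; exact: nbhs_infty_ge.
have /andP[lo up] := max_density_bounds n100.
rewrite distrC ger0_norm; last by rewrite subr_ge0.
rewrite lerBlDl; apply: le_trans up _; rewrite lerD2l.
have nr : 100 <= n%:R :> R by rewrite ler_nat.
rewrite ler_pdivrMr; last lra.
have : 2 / e <= n%:R.
  by near: n; apply: nbhs_infty_ger.
by rewrite ler_pdivrMr // mulrC.
Unshelve. all: by end_near. Qed.

Lemma semi_inducibility_H4 : semi_inducibility R H4 = 4 / 27.
Proof. exact/cvg_lim/cvg_max_density. Qed.

Lemma ES_stable_H4 :
  ES_stable H4 (complete 'I_3) (fun _ : 'I_3 => 1 / 3 : R).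
Proof.
move=> eps eps0; rewrite semi_inducibility_H4.
pose eta : R := Num.min (eps / 4) (1 / 100).
have eta0 : 0 < eta by rewrite lt_min; apply/andP; split; lra.
have eta1 : eta <= 1 / 100 by rewrite ge_min lexx orbT.
have eta4 : eta <= eps / 4 by rewrite ge_min lexx.
have eta3 : 0 < eta ^+ 3 by exact: exprn_gt0.
have eta2 : eta ^+ 2 <= (1 / 100) ^+ 2 by rewrite lerXn2r ?nnegrE //; lra.
(* Half of the allowed loss [eta^3 / 6 * n^4] is given to [delta], the other half to the error
   [n^3]; the latter needs [12 <= eta^3 * n]. *)
exists (eta ^+ 3 / 12); first lra.
exists (maxn 100 (Num.bound (12 / eta ^+ 3))) => T G.
rewrite geq_max => /andP[n100 nb] dens.
set n : R := #|T|%:R.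
have nr : 100 <= n by rewrite ler_nat.
have [n0 n2 n3 n4] : [/\ 0 < n, 0 < n ^+ 2, 0 < n ^+ 3 & 0 < n ^+ 4].
  by split; rewrite ?exprn_gt0 //; lra.
have {nb} nb : 12 <= eta ^+ 3 * n.
  rewrite mulrC -ler_pdivrMr //; apply: ltW.
  have H : 0 <= 12 / eta ^+ 3 by rewrite divr_ge0 // ltW.
  by apply: lt_le_trans (archi_boundP H) _; rewrite ler_nat.
have eta72 : 72 <= eta * n.
  have := ler_wpM2l (ltW (mulr_gt0 eta0 n0)) eta2.
  have := mulr_gt0 eta0 n0; lra.
have [up _ _] := ncap_ffact n100; rewrite -/n in up.
have f0 : 0 < (#|T| ^_ 4)%:R :> R by rewrite ltr0n ffact_gt0 (leq_trans _ n100).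
have fn : (#|T| ^_ 4)%:R <= n ^+ 4 by exact: ffact4_le.
have Ls : Loss R (adj G) <= eta ^+ 3 / 6 * n ^+ 4.
  move: dens; rewrite densityE ler_pdivlMr // /Loss -/n => dens.
  have := ler_wpM2l (ltW eta3) fn.
  have := ler_wpM2r (ltW n3) nb; lra.
have [c [sz ed]] :=
  near_tripartite (@adj_sym _ G) (@adj_irr _ G) eta0 eta1 eta72 Ls.
exists (colour_class c); split; first exact: colour_class_parts.
  move=> i; have -> : #|colour_class c i|%:R = csize R c i.
    rewrite /csize -sum1_card natr_sum big_mkcond /=; apply: eq_bigr => u _.
    by rewrite finset.inE; case: eqP.
  have := sz i; rewrite -/n mul1r (mulrC 3^-1) => H.
  apply: le_lt_trans H _; rewrite ltr_pM2r //; lra.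
rewrite edits_symdiff in ed; set S := #|symdiff _ _|%:R in ed *.
(* As [30000 / 6 * (1 / 100)^2 = 1/2] and [edits] is [2 S], the constant is [eta / 4]. *)
have HS : n ^+ 2 * S <= n ^+ 2 * (eta / 4 * n ^+ 2).
  have := ler_wpM2l (ltW (mulr_gt0 eta0 n4)) eta2; lra.
rewrite ler_pM2l // in HS.
rewrite binR2 -/n; apply: le_trans HS _.
have : n <= n * (n - 1) by rewrite ler_peMr //; lra.
have := ler_wpM2r (ltW n2) eta4; nra.
Qed.

Lemma perfectly_stable_H4 : perfectly_stable R H4 (complete 'I_3).
Proof.
have [C [C4 HC]] := perfect_stability_Lam R.
exists C; split; [lra|by rewrite card_ord|move=> T G nC].
set n : R := #|T|%:R in nC.
have T4 : (4 <= #|T|)%N by rewrite -(ler_nat R); apply: le_trans nC.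
have f0 : 0 < (#|T| ^_ 4)%:R :> R by rewrite ltr0n ffact_gt0.
have [c Hc] := HC T (adj G) _ (@adj_sym _ G) (@adj_irr _ G) nC
  (fun c => Lam_blow_max R c T4).
exists T, (blowup (complete 'I_3) (colour_class c)); split => //.
  by exists (colour_class c) => //; exact: colour_class_parts.
set Del := max_density R H4 _ - _.
have n0 : 0 < n by lra.
have n2 : 0 < n ^+ 2 by exact: exprn_gt0.
have E : Lam R (adj G) = density R H4 G * (#|T| ^_ 4)%:R.
  by rewrite densityE divfK // gt_eqF.
rewrite E -mulrBl -/Del -/n edits_symdiff in Hc.
set S := #|symdiff _ _|%:R in Hc.
have S0 : 0 <= S by exact: ler0n.
have fn : (#|T| ^_ 4)%:R <= n ^+ 4 by exact: ffact4_le.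
(* Read off from [Hc], whose left side is nonnegative. *)
have Del0 : 0 <= Del.
  have : 0 <= C * (Del * (#|T| ^_ 4)%:R).
    by apply: le_trans Hc; rewrite !mulr_ge0 // ltW.
  by rewrite pmulr_rge0 ?pmulr_lge0 //; lra.
apply: (@le_trans _ _ S); first by rewrite ler_nat edit_distance_le.
rewrite -(ler_pM2l n2); have := ler_wpM2l Del0 fn.
have C0 : 0 <= C by lra.
move=> /(ler_wpM2l C0); have := mulr_ge0 (ltW n2) S0; lra.
Qed.
End Limit.

Theorem theorem3p5 (R : realType) :
  [/\ cvgn (max_density R H4) /\ semi_inducibility R H4 = 4 / 27,
      ES_stable H4 (complete 'I_3) (fun _ : 'I_3 => 1 / 3 : R) &
      perfectly_stable R H4 (complete 'I_3)].
Proof.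
split; [split|exact: ES_stable_H4|exact: perfectly_stable_H4].
  by apply/cvg_ex; exists (4 / 27); exact: cvg_max_density.
exact: semi_inducibility_H4.
Qed.
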